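(* Let $K$ be a field, $S=K[x_1,\ldots,x_n]$, and let $I\subset S$ be a monomial ideal with $\dim S/I=0$. Let $L(I)\subset S^\wp$ be the ideal generated by the monomials $x_{1,a_1+1}\cdots x_{n,a_n+1}$ with $x_1^{a_1}\cdots x_n^{a_n}\in\operatorname{Mon}(S\setminus I)$. Then $L(I)^k$ has linear quotients for all $k\ge 1$. In particular, all powers of $L(I)$ have a linear resolution.
   Context: $\operatorname{Mon}(S\setminus I)$ is the (finite) set of monomials of $S$ not belonging to $I$. For $i=1,\ldots,n$ let $b_i\ge 1$ be the smallest integer with $x_i^{b_i}\in I$ (it exists since $\dim S/I=0$). $S^\wp$ is the standard graded polynomial ring over $K$ in the variables $x_{i,j}$, $1\le i\le n$, $1\le j\le b_i$. A monomial ideal $J$ has linear quotients if its minimal monomial generators can be ordered $u_1,\ldots,u_m$ so that for each $j=2,\ldots,m$ the colon ideal $(u_1,\ldots,u_{j-1}):u_j$ is generated by a set of variables. A graded ideal $J$ generated in a single degree $d$ has a linear resolution if its graded Betti numbers satisfy $\beta_{i,i+j}(J)=0$ for all $i$ and all $j\neq d$. *)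

(* Defs.v *)
From Stdlib Require Import ClassicalEpsilon.
From mathcomp Require Import all_boot all_order all_algebra.
From mathcomp Require Import mpoly.

Set Implicit Arguments.
Unset Strict Implicit.
Unset Printing Implicit Defensive.

Import GRing.Theory.
Local Open Scope ring_scope.

(* Ideals are Prop-valued predicates: the coefficient field is arbitrary, so  *)
(* membership is not assumed decidable. Two ideals are equal when they have   *)
(* the same elements ([same_ideal]).                                          *)

Section Ideals.
Variable A : comNzRingType.
Implicit Types (I J P : A -> Prop).

Definition is_ideal J : Prop :=
  [/\ J 0,
      forall f g, J f -> J g -> J (f + g)
    & forall r f, J f -> J (r * f)].

Definition same_ideal I J : Prop := forall f, I f <-> J f.

Definition ideal_gen (G : A -> Prop) : A -> Prop :=
  fun f => forall J, is_ideal J -> (forall g, G g -> J g) -> J f.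

Definition ideal_mul I J : A -> Prop :=
  ideal_gen (fun h => exists f g, [/\ I f, J g & h = f * g]).

Fixpoint ideal_exp J (k : nat) : A -> Prop :=
  if k is k'.+1 then ideal_mul J (ideal_exp J k') else (fun=> True).

Definition ideal_colon J (u : A) : A -> Prop := fun f => J (f * u).

Definition is_prime_ideal P : Prop :=
  [/\ is_ideal P, ~ P 1 & forall f g, P (f * g) -> P f \/ P g].

(* Q_0 < ... < Q_d: the primes of A/I are the primes of A containing I. *)
Definition quot_prime_chain I (d : nat) (Q : nat -> A -> Prop) : Prop :=
  (forall i, (i <= d)%N -> is_prime_ideal (Q i) /\ (forall f, I f -> Q i f)) /\
  (forall i, (i < d)%N ->
     (forall f, Q i f -> Q i.+1 f) /\ (exists f, Q i.+1 f /\ ~ Q i f)).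

(* The Krull dimension of A/I is d. *)
Definition quot_krull_dim I (d : nat) : Prop :=
  (exists Q, quot_prime_chain I d Q) /\
  (forall e Q, quot_prime_chain I e Q -> (e <= d)%N).

End Ideals.

Section MonomialIdeals.
Variables (K : fieldType) (n : nat).
Implicit Types (I J : {mpoly K[n]} -> Prop) (s t : seq 'X_{1..n}).

Definition is_monomial_ideal J : Prop :=
  same_ideal J (ideal_gen (fun f => exists2 m, J 'X_[m] & f = 'X_[m])).

Definition mon_ideal s : {mpoly K[n]} -> Prop :=
  ideal_gen (fun f => exists2 m, m \in s & f = 'X_[m]).

Definition min_mon_gens J s : Prop :=
  [/\ uniq s,
      same_ideal J (mon_ideal s)
    & forall t, {subset t <= s} -> same_ideal J (mon_ideal t) ->
        {subset s <= t}].

Definition has_linear_quotients J : Prop :=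
  is_monomial_ideal J /\
  exists2 s, min_mon_gens J s &
    forall j, (0 < j < size s)%N ->
      exists V : {set 'I_n},
        same_ideal (ideal_colon (mon_ideal (take j s)) 'X_[nth 0%MM s j])
                   (ideal_gen (fun f => exists2 v, v \in V & f = 'X_v)).

End MonomialIdeals.

(* Graded free resolutions. F_i is free of rank [rk F i], its a-th basis      *)
(* vector having degree [shift F i a]. Elements are row vectors, and maps act *)
(* by right multiplication: [diff F i] is F_(i+1) -> F_i and [aug F] is       *)
(* F_0 -> J.                                                                  *)

Section Resolutions.
Variables (K : fieldType) (n : nat).
Let S := {mpoly K[n]}.

(* p lies in the component of degree d of S, which is 0 for d < 0. *)
Definition in_degree (d : int) (p : S) : Prop :=
  match d with
  | Posz e => p \is e.-homog
  | Negz _ => p = 0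
  end.

Record free_complex := FreeComplex {
  rk : nat -> nat;
  shift : forall i, 'I_(rk i) -> int;
  aug : 'cV[S]_(rk 0);
  diff : forall i, 'M[S]_(rk i.+1, rk i)
}.

Definition graded_complex (F : free_complex) : Prop :=
  (forall a, in_degree (shift a) (aug F a 0)) /\
  (forall i a b, in_degree (shift a - shift b) (diff F i a b)).

Definition resolves (J : S -> Prop) (F : free_complex) : Prop :=
  [/\ forall f, J f <-> exists v : 'rV_(rk F 0), f = (v *m aug F) 0 0,
      forall v : 'rV_(rk F 0), v *m aug F = 0 <-> exists w, v = w *m diff F 0
    & forall i (v : 'rV_(rk F i.+1)),
        v *m diff F i = 0 <-> exists w, v = w *m diff F i.+1].

(* d(F_(i+1)) is contained in m F_i, with m the graded maximal ideal. *)
Definition minimal_complex (F : free_complex) : Prop :=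
  forall i a b, (diff F i a b)@_0%MM = 0.

Definition minimal_graded_resolution (J : S -> Prop) (F : free_complex) : Prop :=
  [/\ graded_complex F, resolves J F & minimal_complex F].

(* The multiplicity of S(-j) as a summand of F_i; for a minimal graded free   *)
(* resolution F of J this is the graded Betti number beta_(i,j)(J).           *)
Definition betti (F : free_complex) (i : nat) (j : int) : nat :=
  #|[set a : 'I_(rk F i) | shift a == j]|.

Definition generated_in_degree (d : nat) (J : S -> Prop) : Prop :=
  same_ideal J (ideal_gen (fun f => J f /\ f \is d.-homog)).

(* Betti numbers do not depend on the minimal resolution, so the condition is *)
(* imposed on all of them; their existence is part of the definition so that  *)
(* it cannot hold vacuously.                                                  *)
Definition has_linear_resolution (J : S -> Prop) : Prop :=
  exists d : nat,
    [/\ generated_in_degree d J,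
        exists F, minimal_graded_resolution J F
      & forall F, minimal_graded_resolution J F ->
          forall (i : nat) (j : int), j != d%:Z -> betti F i (i%:Z + j) = 0%N].

End Resolutions.

Section Letterplace.
Variables (K : fieldType) (n : nat) (I : {mpoly K[n]} -> Prop).

(* b_i, the least exponent b with x_i^b in I (arbitrary if there is none). *)
Definition min_pow (i : 'I_n) : nat :=
  epsilon (inhabits 0%N)
    (fun b => I ('X_i ^+ b) /\ forall c, I ('X_i ^+ c) -> (b <= c)%N).

(* (i, j) with j counted from 0: it stands for x_{i,j+1}. *)
Definition pvar : finType := {i : 'I_n & 'I_(min_pow i)}.

Definition Swp := {mpoly K[#|{: pvar}|]}.

Definition pX (i : 'I_n) (j : 'I_(min_pow i)) : Swp :=
  'X_(enum_rank (Tagged (fun i => 'I_(min_pow i)) j : pvar)).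

(* Since x^a is not in I, a_i < b_i, so the index a_i is always available. *)
Definition L_ideal : Swp -> Prop :=
  ideal_gen (fun f : Swp =>
    exists (a : 'X_{1..n}) (c : forall i, 'I_(min_pow i)),
      [/\ ~ I 'X_[a], forall i, c i = a i :> nat & f = \prod_i pX (c i)]).

End Letterplace.

Arguments min_pow {K n} I i.
Arguments pX {K n} I i j.
Arguments L_ideal {K n} I _.

(* Main.v *)
(* The monomials spanning L(I) are the transversals of the blocks             *)
(* {x_{i,1}, ..., x_{i,b_i}} whose index vectors form a down-closed set, so   *)
(* replacing a variable by an earlier one of its block stays inside the set.  *)
(* This exchange property and the multidegree (k, ..., k) pass to products,   *)
(* hence to the generators of L(I)^k. In decreasing lexicographic order, if   *)
(* m precedes u and x_v is the first variable where they differ, then m has   *)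
(* the larger exponent, u has a larger exponent at some later x_w of the same *)
(* block, and u x_v / x_w precedes u: the colon ideals are generated by       *)
(* variables.                                                                 *)
(* Mapping cones over the colon ideals then build a linear resolution (the    *)
(* Koszul complex being the case of an ideal of variables). For another       *)
(* minimal graded resolution F, the identity of F factors through the linear  *)
(* one up to homotopy; homotopies vanish modulo the maximal ideal, so each    *)
(* basis vector of F has the degree of the corresponding linear strand.       *)

Require Import Defs.
From Stdlib Require Import ClassicalEpsilon.
From mathcomp Require Import all_boot all_order all_algebra.
From mathcomp Require Import mpoly.

Set Implicit Arguments.
Unset Strict Implicit.
Unset Printing Implicit Defensive.

Import GRing.Theory.
Local Open Scope ring_scope.

(** Both halves rest on one property of a finite set of monomials in blocks of ranked variables: it
    is [polystable] if replacing a variable by one of lower rank in the same block never leaves the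
    set. The monomials spanning L(I) are polystable because divisors of monomials outside I are
    outside I ([L_mons_polystable]), and they have degree 1 in each block ([L_mons_homog]).
    Polystability and block degrees pass to products ([polystable_mul], [block_homog_mul]), so
    L(I)^k is spanned by a polystable set of degree k in every block. For such a set,
    [polystable_slide] gives the exchange behind linear quotients in decreasing lexicographic order
    ([polystable_linear_colons]).

    Let J be generated by the monomials before u, of degree d, and let C = J : u. The sequence 0 ->
    S/C(-d) -> S/J -> S/(J + (u)) -> 0 is exact, so linear resolutions of J and C combine into one
    of J + (u) by a mapping cone ([cone_resolution]); an ideal C of variables is resolved by the
    same construction ([linearly_resolved_vars]). The shifts of every minimal graded resolution are
    then forced by comparison with this one ([minimal_shift]). *)

(** * Homogeneous components and graded lifting *)

Section HomogeneousParts.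
Variables (K : fieldType) (n : nat).
Implicit Types (p q : {mpoly K[n]}) (a b : int).

Lemma in_degree0 a : in_degree a (0 : {mpoly K[n]}).
Proof. by case: a => //= d; exact: rpred0. Qed.

Lemma in_degreeD a p q : in_degree a p -> in_degree a q -> in_degree a (p + q).
Proof.
case: a => [d|d] /=; first exact: rpredD.
by move=> -> ->; rewrite addr0.
Qed.

Lemma in_degreeN a p : in_degree a p -> in_degree a (- p).
Proof. by case: a => [d|d] /=; rewrite ?rpredN // => ->; rewrite oppr0. Qed.

Lemma in_degree_sum a (T : finType) (F : T -> {mpoly K[n]}) :
  (forall t, in_degree a (F t)) -> in_degree a (\sum_t F t).
Proof.
move=> hF; apply: big_rec => [|t p _ hp]; first exact: in_degree0.
exact: in_degreeD.
Qed.

Lemma in_degreeM a b p q :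
  in_degree a p -> in_degree b q -> in_degree (a + b) (p * q).
Proof.
case: a b => [a|a] [b|b] hp hq; first exact: dhomogM.
- by rewrite (hq : q = 0) mulr0; exact: in_degree0.
- by rewrite (hp : p = 0) mul0r; exact: in_degree0.
- by rewrite (hp : p = 0) mul0r; exact: in_degree0.
Qed.

Lemma in_degree_coeff0 a p : in_degree a p -> a != 0 -> p@_0%MM = 0.
Proof.
case: a => [d|d] /=; last by move=> ->; rewrite mcoeff0.
by move=> hp hd; apply: (dhomog_nemf_coeff hp); rewrite mf0 eq_sym.
Qed.

Definition hpart a p : {mpoly K[n]} :=
  if a is Posz d then pihomog mdeg d p else 0.

Lemma hpart_in_degree a p : in_degree a (hpart a p).
Proof. by case: a => //= d; exact: pihomogP. Qed.

Lemma hpart_homog a (d : nat) p :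
  p \is d.-homog -> hpart a p = if a == d then p else 0.
Proof.
case: a => [e|e] //= hp; rewrite eqz_nat; case: eqVneq => [->|ne].
  exact: pihomog_dE.
by apply: pihomog_ne0 hp; rewrite eq_sym.
Qed.

Lemma hpart_id a p : in_degree a p -> hpart a p = p.
Proof. by case: a => //= d; exact: pihomog_dE. Qed.

Lemma hpart_sum a (T : finType) (F : T -> {mpoly K[n]}) :
  hpart a (\sum_t F t) = \sum_t hpart a (F t).
Proof. by case: a => [d|d] /=; rewrite ?raddf_sum // big1. Qed.

Lemma hpartM a (d : nat) p q :
  q \is d.-homog -> hpart (a + d) (p * q) = hpart a p * q.
Proof.
move=> hq; rewrite {1 2}(pihomog_partitionE (mf := mdeg) (leqnn (msize p))).
rewrite mulr_suml !hpart_sum mulr_suml; apply: eq_bigr => i _.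
have hi := pihomogP mdeg i p.
rewrite (hpart_homog _ (dhomogM hi hq)) (hpart_homog _ hi) PoszD.
by rewrite (inj_eq (addIr _)); case: ifP; rewrite ?mul0r.
Qed.

(** The given lifts of the rows need not be homogeneous; since [D] is homogeneous of degree d,
    keeping only the component of degree [a i] of each coefficient still lifts row i. *)
Lemma graded_factor s c r (X : 'M[{mpoly K[n]}]_(s, c))
    (D : 'M[{mpoly K[n]}]_(r, c)) (a : 'I_s -> int) (d : nat) :
    (forall i j, in_degree (a i + d) (X i j)) ->
    (forall i j, D i j \is d.-homog) ->
    (forall i, exists w, row i X = w *m D) ->
  exists2 Y : 'M_(s, r), X = Y *m D & forall i j, in_degree (a i) (Y i j).
Proof.
move=> hX hD /fin_all_exists [w hw].
exists (\matrix_(i, j) hpart (a i) (w i 0 j)) => [|i j]; last first.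
  by rewrite mxE; exact: hpart_in_degree.
apply/matrixP => i j; rewrite -(hpart_id (hX i j)).
have /matrixP/(_ 0 j) := hw i; rewrite !mxE => ->.
rewrite hpart_sum; apply: eq_bigr => l _.
by rewrite (hpartM _ _ (hD l j)) mxE.
Qed.

End HomogeneousParts.

(* Index shift: a resolution of J is stored as a complex ending in S, with    *)
(* J the image of the last map E 0.                                           *)
Definition tail_rk (r : nat -> nat) (i : nat) : nat :=
  if i is j.+1 then r j else 1%N.

Definition linear_deg (d i : nat) : nat := if i is 0 then d else 1%N.

(** * Linear resolutions as complexes ending in S *)

Section Resolutions.
Variables (K : fieldType) (n : nat).
Local Notation S := {mpoly K[n]}.

Definition resolution (J : S -> Prop) (r : nat -> nat)
    (E : forall i, 'M[S]_(r i, tail_rk r i)) : Prop :=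
  (forall f, J f <-> exists v : 'rV_(r 0%N), f%:M = v *m E 0%N) /\
  (forall i (v : 'rV_(r i)), v *m E i = 0 <-> exists w, v = w *m E i.+1).

Definition linear_resolution (d : nat) (J : S -> Prop) (r : nat -> nat)
    (E : forall i, 'M[S]_(r i, tail_rk r i)) : Prop :=
  resolution J E /\ forall i a b, E i a b \is (linear_deg d i).-homog.

Definition linearly_resolved (d : nat) (J : S -> Prop) : Prop :=
  exists r E, @linear_resolution d J r E.

Lemma linear_resolution_ext d (I J : S -> Prop) r E :
  same_ideal I J -> @linear_resolution d I r E -> linear_resolution d J E.
Proof.
by move=> hIJ [[h0 h1] h2]; split=> //; split=> // f; rewrite -h0 hIJ.
Qed.

Lemma linearly_resolved_ext d (I J : S -> Prop) :
  same_ideal I J -> linearly_resolved d I -> linearly_resolved d J.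
Proof.
by move=> hIJ [r [E hE]]; exists r, E; exact: linear_resolution_ext hE.
Qed.

(** The zero complex is linear for every d, so it can start each induction on generators. *)
Lemma linearly_resolved0 d : linearly_resolved d (fun f => f = 0).
Proof.
exists (fun=> 0%N), (fun=> 0); split; last by move=> i [].
split=> [f|i v]; split.
- by move=> ->; exists 0; rewrite mulmx0; apply/matrixP=> i j; rewrite !mxE mul0rn.
- by case=> v /matrixP/(_ 0 0); rewrite mulmx0 !mxE.
- by move=> _; exists 0; apply/rowP; case.
- by move=> _; rewrite mulmx0.
Qed.

Section Complex.
Variables (J : S -> Prop) (r : nat -> nat).
Variable (E : forall i, 'M[S]_(r i, tail_rk r i)).
Hypothesis hE : resolution J E.

Lemma resolution_comp i : E i.+1 *m E i = 0.
Proof.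
apply/row_matrixP => a; rewrite row_mul row0; apply/hE.2.
by exists (delta_mx 0 a); rewrite -rowE.
Qed.

Lemma resolution_image s i (X : 'M[S]_(s, r i)) :
  X *m E i = 0 -> forall a, exists w, row a X = w *m E i.+1.
Proof. by move=> hX a; apply/hE.2; rewrite -row_mul hX row0. Qed.

Lemma resolution_ideal s (X : 'M[S]_(s, 1)) :
  (forall a, J (X a 0)) -> forall a, exists w, row a X = w *m E 0%N.
Proof.
move=> hX a; have /hE.1 [w hw] := hX a; exists w; rewrite -hw.
by apply/rowP => j; rewrite !mxE !ord1 mulr1n.
Qed.

Lemma resolution_in_ideal a : J (E 0%N a 0).
Proof.
apply/hE.1; exists (delta_mx 0 a); rewrite -rowE.
by apply/rowP => j; rewrite !mxE !ord1 mulr1n.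
Qed.

End Complex.

Lemma linear_deg1 i : linear_deg 1 i = 1%N.
Proof. by case: i. Qed.

Lemma mx_factor s c r (X : 'M[S]_(s, c)) (D : 'M[S]_(r, c)) :
  (forall i, exists w, row i X = w *m D) -> exists Y, X = Y *m D.
Proof.
move=> /fin_all_exists [w hw]; exists (\matrix_i w i).
by apply/row_matrixP => i; rewrite row_mul rowK.
Qed.

(** * Mapping cone over a colon ideal *)

Section MappingCone.
Variables (d : nat) (J C : S -> Prop) (u : S).
Variables (r rC : nat -> nat).
Variable E : forall i, 'M[S]_(r i, tail_rk r i).
Variable EC : forall i, 'M[S]_(rC i, tail_rk rC i).
Hypothesis hE : linear_resolution d J E.
Hypothesis hEC : linear_resolution 1 C EC.
Hypothesis hu : u \is d.-homog.
Hypothesis hC : forall f, C f <-> J (f * u).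

(** Choice by [epsilon] lets [cone_map] be a plain recursion, written before the lifts are known to
    exist. *)
Definition homog_factor s c r (X : 'M[S]_(s, c)) (D : 'M[S]_(r, c)) : 'M_(s, r) :=
  epsilon (inhabits 0) (fun Y => X = Y *m D /\ forall a b, Y a b \is 1.-homog).

Lemma homog_factorP s c r' (X : 'M[S]_(s, c)) (D : 'M[S]_(r', c)) :
    (exists Y, X = Y *m D /\ forall a b, Y a b \is 1.-homog) ->
  X = homog_factor X D *m D /\ forall a b, homog_factor X D a b \is 1.-homog.
Proof.
exact: (@epsilon_spec _ (inhabits 0)
  (fun Y => X = Y *m D /\ forall a b, Y a b \is 1.-homog)).
Qed.

(* Anticommuting lift of multiplication by u. *)
Fixpoint cone_map i : 'M[S]_(tail_rk rC i, tail_rk r i) :=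
  match i return 'M[S]_(tail_rk rC i, tail_rk r i) with
  | 0%N => u%:M
  | j.+1 => homog_factor (- (EC j *m cone_map j)) (E j)
  end.

(** [cone_map i] and [E i] have entries of the same degree and [EC i] is linear, so the lift through
    [E i] can be taken linear. *)
Lemma cone_map_step i :
    (forall a b, cone_map i a b \is (linear_deg d i).-homog) ->
    (forall a, exists w, row a (- (EC i *m cone_map i)) = w *m E i) ->
  - (EC i *m cone_map i) = cone_map i.+1 *m E i /\
    (forall a b, cone_map i.+1 a b \is 1.-homog).
Proof.
move=> h1 h2 /=; apply: homog_factorP.
have [|||Y hY hY1] := @graded_factor K n _ _ _ (- (EC i *m cone_map i)) (E i)
    (fun=> 1%:Z) (linear_deg d i).
- move=> a b; rewrite !mxE; apply: in_degreeN; apply: in_degree_sum => l.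
  by apply: dhomogM (h1 _ _); rewrite -(linear_deg1 i); exact: hEC.2.
- exact: hE.2.
- exact: h2.
- by exists Y; split.
Qed.

Lemma cone_map_spec i :
  (forall a b, cone_map i a b \is (linear_deg d i).-homog) /\
  (forall a, exists w, row a (- (EC i *m cone_map i)) = w *m E i).
Proof.
elim: i => [|i [IH1 IH2]]; last first.
  have [eq_i hi] := cone_map_step IH1 IH2; split=> [|a]; first exact: hi.
  have h0 : - (EC i.+1 *m cone_map i.+1) *m E i = 0.
    rewrite mulNmx -mulmxA -eq_i mulmxN opprK mulmxA.
    by rewrite (resolution_comp hEC.1) mul0mx.
  exact: (resolution_image hE.1 h0 a).
split=> [a b|a] /=; first by rewrite !ord1 mxE eqxx mulr1n.
apply: (resolution_ideal hE.1) => {}a.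
(* The entries of [EC 0] lie in C, so their multiples by u lie in J. *)
have /hC hJ := resolution_in_ideal hEC.1 a.
have [w hw] := (hE.1.1 _).1 hJ.
apply/hE.1.1; exists (- w); rewrite mulNmx -hw.
by apply/rowP => j; rewrite ord1 !mxE big_ord1 !mxE eqxx !mulr1n.
Qed.

Lemma cone_mapE i : cone_map i.+1 *m E i = - (EC i *m cone_map i).
Proof. by have [h1 h2] := cone_map_spec i; rewrite (cone_map_step h1 h2).1. Qed.

(** At i = 0 the second summand has rank 1: it is the new generator u, and the resolution of C
    enters one step later. *)
Definition cone_rk i := (r i + tail_rk rC i)%N.

Definition cone_diff i : 'M[S]_(cone_rk i, tail_rk cone_rk i) :=
  match i return 'M[S]_(cone_rk i, tail_rk cone_rk i) with
  | 0%N => col_mx (E 0%N) (cone_map 0)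
  | j.+1 => block_mx (E j.+1) 0 (cone_map j.+1) (EC j)
  end.

(** Subtracting the boundary of (0, k') from (g, k) kills the second component and leaves a cycle of
    [E], which is a boundary. *)
Lemma cone_exact i (g : 'rV_(r i)) (k : 'rV_(tail_rk rC i)) :
  (g *m E i + k *m cone_map i = 0 /\ exists k' : 'rV_(rC i), k = k' *m EC i) <->
  exists w : 'rV_(r i.+1 + rC i),
    row_mx g k = w *m block_mx (E i.+1) 0 (cone_map i.+1) (EC i).
Proof.
split=> [[hg [k' hk]]|[w]].
  have : (g - k' *m cone_map i.+1) *m E i = 0.
    by rewrite mulmxBl -mulmxA cone_mapE mulmxN opprK mulmxA -hk.
  case/hE.1.2 => g' hg'; exists (row_mx g' k').
  by rewrite mul_row_block -hg' subrK mulmx0 add0r -hk.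
rewrite -[w]hsubmxK mul_row_block mulmx0 add0r => /eq_row_mx [-> ->].
split; last by eexists.
rewrite mulmxDl -!mulmxA (resolution_comp hE.1) mulmx0 add0r cone_mapE.
by rewrite mulmxN addNr.
Qed.

Lemma cone_resolution :
  linear_resolution d (fun f => exists g c, J g /\ f = g + c * u) cone_diff.
Proof.
split; last first.
  case=> [|i] a b /=.
    rewrite mxE; case: splitP => l _; first exact: (hE.2 0%N).
    by rewrite mxE !ord1 eqxx mulr1n.
  rewrite !mxE; case: splitP => l _; rewrite !mxE; case: splitP => m _.
  - exact: (hE.2 i.+1).
  - by rewrite mxE rpred0.
  - exact: (cone_map_spec i.+1).1.
  - by rewrite -(linear_deg1 i); exact: hEC.2.
split=> [f|].
  split=> [[g [c [/hE.1.1 [v hv] ->]]]|[v]].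
    exists (row_mx v c%:M); rewrite mul_row_col -hv /=.
    by apply/rowP => j; rewrite mul_scalar_mx !mxE mulrnAr mulrnDl.
  rewrite -[v]hsubmxK mul_row_col => /matrixP/(_ 0 0).
  rewrite mxE eqxx mulr1n => ->.
  exists ((lsubmx v *m E 0%N) 0 0), (rsubmx v 0 0); split.
    by apply/hE.1.1; exists (lsubmx v); apply/rowP => j; rewrite !ord1 mxE mulr1n.
  by rewrite mxE; congr (_ + _); rewrite mxE big_ord1 [u%:M _ _]mxE eqxx mulr1n.
move=> i v; rewrite -[v]hsubmxK; apply: iff_trans (cone_exact _ _).
case: i v => [|i] v.
  rewrite mul_row_col; split=> [hv|[]//]; split=> //.
  (* In a relation between u and the generators of J, the coefficient of u lies in J : u = C, hence
     in the image of [EC 0]. *)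
  have hk : C (rsubmx v 0 0).
    apply/hC/hE.1.1; exists (- lsubmx v).
    rewrite mulNmx; apply/eqP; rewrite -addr_eq0 addrC; apply/eqP; apply: etrans hv.
    congr (_ + _); apply/rowP => j.
    by rewrite !ord1 !mxE big_ord1 !mxE eqxx !mulr1n.
  have [w hw] := (hEC.1.1 _).1 hk; exists w; rewrite -hw.
  by apply/rowP => j; rewrite [RHS]mxE !ord1 mulr1n.
rewrite mul_row_block mulmx0 add0r; split.
  move=> hv; have /eq_row_mx [h1 /hEC.1.2 h2] : row_mx
      (lsubmx v *m E i.+1 + rsubmx v *m cone_map i.+1) (rsubmx v *m EC i) =
    row_mx 0 0 by rewrite row_mx0.
  by [].
by case=> h1 /hEC.1.2 h2; rewrite h1 h2 row_mx0.
Qed.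

End MappingCone.

(** * Shifts of an arbitrary minimal graded resolution *)

Definition full_diff (F : free_complex K n) i :
    'M[S]_(rk F i, tail_rk (rk F) i) :=
  match i return 'M[S]_(rk F i, tail_rk (rk F) i) with
  | 0%N => aug F
  | j.+1 => diff F j
  end.

Definition tail_shift (F : free_complex K n) i : 'I_(tail_rk (rk F) i) -> int :=
  match i return 'I_(tail_rk (rk F) i) -> int with
  | 0%N => fun=> 0
  | j.+1 => @shift K n F j
  end.

Definition linear_shift (d i : nat) : int := if i is j.+1 then (d + j)%:Z else 0.

Lemma linear_shiftS d i : linear_shift d i.+1 = linear_shift d i + linear_deg d i.
Proof. by case: i => [|i] /=; rewrite ?addn0 ?add0r // addnS -addn1 PoszD. Qed.

Lemma resolves_full (J : S -> Prop) F :
  resolves J F <-> resolution J (full_diff F).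
Proof.
have eq_mx f (v : 'rV_(rk F 0)) : f = (v *m aug F) 0 0 <-> f%:M = v *m aug F.
  split=> [->|<-]; last by rewrite mxE mulr1n.
  by apply/rowP=> j; rewrite [LHS]mxE !ord1 mulr1n.
split=> [[h0 h1 h2]|[h0 h1]].
  split=> [f|[|i] v]; [|exact: h1|exact: h2].
  by rewrite h0; split=> -[v /eq_mx hv]; exists v.
split=> [f|v|i v]; [|exact: (h1 0%N)|exact: (h1 i.+1)].
by rewrite h0; split=> -[v /eq_mx hv]; exists v.
Qed.

Lemma mcoeff0M (p q : S) : (p * q)@_0%MM = p@_0%MM * q@_0%MM.
Proof. exact: (mcoeff0_is_multiplicative _ _).1. Qed.

Definition const_free s c (X : 'M[S]_(s, c)) : Prop :=
  forall a b, (X a b)@_0%MM = 0.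

Lemma const_freeMl s c r (X : 'M[S]_(s, c)) (Y : 'M[S]_(c, r)) :
  const_free X -> const_free (X *m Y).
Proof.
move=> hX a b; rewrite mxE raddf_sum big1 // => l _.
by rewrite /= mcoeff0M hX mul0r.
Qed.

Lemma const_freeMr s c r (X : 'M[S]_(s, c)) (Y : 'M[S]_(c, r)) :
  const_free Y -> const_free (X *m Y).
Proof.
move=> hY a b; rewrite mxE raddf_sum big1 // => l _.
by rewrite /= mcoeff0M hY mulr0.
Qed.

Section MinimalShifts.
Variables (d : nat) (J : S -> Prop) (r : nat -> nat).
Variable E : forall i, 'M[S]_(r i, tail_rk r i).
Variable F : free_complex K n.
Hypothesis hE : linear_resolution d J E.
Hypothesis hF : minimal_graded_resolution J F.

Let D := full_diff F.

Lemma full_diff_resolution : resolution J D.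
Proof. by case: hF => _ /resolves_full. Qed.

Lemma full_diff_degree i a b :
  in_degree (@tail_shift F i.+1 a - tail_shift b) (D i a b).
Proof.
case: hF => -[h0 h1] _ _; case: i a b => [|i] a b; last exact: h1.
by rewrite subr0 (ord1 b); exact: h0.
Qed.

(* [phi] and [psi] are comparison maps in both directions, and               *)
(* [h *m D i + T] is a null-homotopy of [phi *m psi - 1] whose entries lie in *)
(* the maximal ideal.                                                         *)
Lemma comparison i :
  exists (phi : 'M[S]_(tail_rk (rk F) i, tail_rk r i))
         (psi : 'M[S]_(tail_rk r i, tail_rk (rk F) i))
         (h : 'M[S]_(tail_rk (rk F) i, rk F i))
         (T : 'M[S]_(tail_rk (rk F) i, tail_rk (rk F) i)),
  [/\ forall a b, in_degree (tail_shift a - linear_shift d i) (phi a b),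
      (forall a, exists w, row a (D i *m phi) = w *m E i) /\
      (forall a, exists w, row a (E i *m psi) = w *m D i),
      phi *m psi - 1%:M = h *m D i + T,
      D i *m T = 0 & const_free T /\ const_free (h *m D i) /\ const_free (D i *m h)].
Proof.
have hD := full_diff_resolution.
elim: i => [|i [phi [psi [h [T [hphi [imD imE] hpsi hT [hT0 [hhD hDh]]]]]]]].
  (* The zero homotopy meets the constant-term conditions whatever [D 0] is; the augmentation may
     have unit entries. *)
  exists 1%:M, 1%:M, 0, 0; rewrite !mulmx1 !mulmx0 mul0mx subrr addr0.
  split=> //.
  - by move=> a b; rewrite /= !ord1 mxE; exact: dhomog1.
  - split=> a; first apply: (resolution_ideal hE.1) => {}a.
      exact: resolution_in_ideal hD a.
    apply: (resolution_ideal hD) => {}a.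
    exact: resolution_in_ideal hE.1 a.
  - by split=> [a b|]; last split=> a b; rewrite mxE mcoeff0.
have [|phi' hphi' dphi'] :=
    graded_factor (a := fun a : 'I_(rk F i) => @tail_shift F i.+1 a - linear_shift d i.+1)
      _ (hE.2 i) imD.
  move=> a b; rewrite linear_shiftS opprD addrA subrK mxE; apply: in_degree_sum => l.
  have := in_degreeM (full_diff_degree a l) (hphi l b).
  by rewrite addrA subrK.
(* Any lift of [psi] will do: the final degree argument reads only [phi]. *)
have [psi' hpsi'] := mx_factor imE.
(* Moving [D i] to the left past both lifts gives [D i *m (phi *m psi - 1 - h *m D i)], that is
   [D i *m T]. *)
have hZ : (phi' *m psi' - 1%:M - D i *m h) *m D i = 0.
  rewrite !mulmxBl -mulmxA -hpsi' mulmxA -hphi' -!mulmxA mul1mx.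
  rewrite -{2}[D i]mulmx1 -!mulmxBr.
  by rewrite hpsi addrC addKr.
have [h' hh'] := mx_factor (resolution_image hD hZ).
exists phi', psi', h', (D i *m h); split=> //.
- split=> a.
    have h0 : D i.+1 *m phi' *m E i = 0.
      by rewrite -mulmxA -hphi' mulmxA (resolution_comp hD) mul0mx.
    exact: (resolution_image hE.1 h0).
  have h0 : E i.+1 *m psi' *m D i = 0.
    by rewrite -mulmxA -hpsi' mulmxA (resolution_comp hE.1) mul0mx.
  exact: (resolution_image hD h0).
- by rewrite -hh' subrK.
- by rewrite mulmxA (resolution_comp hD) mul0mx.
have hmin : const_free (D i.+1) by case: hF => _ _ /(_ i).
by split=> //; split; [exact: const_freeMr|exact: const_freeMl].
Qed.

(** Otherwise row a of [phi] has entries of nonzero degree, without constant terms, and the diagonal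
    entry at a of [phi *m psi - 1] has constant term -1, against [comparison]. *)
Lemma minimal_shift i (a : 'I_(rk F i)) : shift a = (d + i)%:Z.
Proof.
have [phi [psi [h [T [hphi _ heq _ [hT [hhD _]]]]]]] := comparison i.+1.
case: (eqVneq (shift a) (d + i)%:Z) => // ne.
have /matrixP/(_ a a)/(congr1 (mcoeff 0%MM)) := heq.
rewrite [in LHS]mxE [in RHS]mxE !mcoeffD hhD hT addr0.
rewrite [X in X@_0%MM + _]mxE raddf_sum big1.
  rewrite add0r !mxE eqxx mulr1n mcoeffN mcoeff1 eqxx => /eqP.
  by rewrite oppr_eq0 oner_eq0.
move=> l _; rewrite /= mcoeff0M (in_degree_coeff0 (hphi a l)) ?mul0r //.
by rewrite subr_eq0.
Qed.

End MinimalShifts.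

Definition linear_complex d r (E : forall i, 'M[S]_(r i, tail_rk r i)) :
    free_complex K n :=
  FreeComplex (rk := r) (fun i (_ : 'I_(r i)) => (d + i)%:Z)
    (E 0%N : 'cV[S]_(r 0%N)) (fun i => E i.+1 : 'M[S]_(r i.+1, r i)).

Lemma linear_complex_minimal d (J : S -> Prop) r E :
  @linear_resolution d J r E -> minimal_graded_resolution J (linear_complex d E).
Proof.
move=> [hE homE]; split.
- split=> [a|i a b]; first by rewrite /= addn0; exact: homE.
  rewrite /= addnS -addn1 PoszD addrC addKr; exact: (homE i.+1).
- by apply/resolves_full; case: hE => h0 h1; split=> // -[|i]; [exact: (h1 0%N)|exact: (h1 i.+1)].
- move=> i a b; apply: (in_degree_coeff0 (a := 1%:Z)) => //; exact: (homE i.+1).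
Qed.

Lemma linearly_resolved_linear_resolution d (J : S -> Prop) :
  generated_in_degree d J -> linearly_resolved d J -> has_linear_resolution J.
Proof.
move=> hJ [r [E hE]]; exists d; split=> //.
  by exists (linear_complex d E); exact: linear_complex_minimal.
move=> F hF i j ne; rewrite /betti; apply: eq_card0 => a.
rewrite inE (minimal_shift hE hF) PoszD addrC (inj_eq (addrI _)).
by rewrite eq_sym (negPf ne).
Qed.

End Resolutions.

(** * Ideals given by generators *)

Section GeneratedIdeals.
Variable A : comNzRingType.
Implicit Types (G J : A -> Prop).

Lemma ideal_genP G : is_ideal (ideal_gen G).
Proof.
split=> [J [] //|f g hf hg J hJ hG|a f hf J hJ hG]; case: (hJ) => _ hD hM.
  by apply: hD; [exact: hf|exact: hg].
by apply: hM; exact: hf.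
Qed.

Lemma mem_ideal_gen G g : G g -> ideal_gen G g.
Proof. by move=> hg J _; apply. Qed.

Lemma ideal_gen_sub G J :
  is_ideal J -> (forall g, G g -> J g) -> forall f, ideal_gen G f -> J f.
Proof. by move=> hJ hG f; apply. Qed.

Lemma is_ideal_ext J J' : same_ideal J J' -> is_ideal J -> is_ideal J'.
Proof.
move=> h [h0 hD hM]; split=> [|f g /h hf /h hg|a f /h hf]; apply/h => //.
- exact: hD.
- exact: hM.
Qed.

Lemma ideal_sum J (T : eqType) (s : seq T) (F : T -> A) :
  is_ideal J -> (forall t, t \in s -> J (F t)) -> J (\sum_(t <- s) F t).
Proof. by case=> h0 hD _ hF; rewrite big_seq; apply: big_ind. Qed.

End GeneratedIdeals.

(** * Monomial ideals: from linear colons to linear resolutions *)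

Section MonomialGenerators.
Variables (K : fieldType) (N : nat).
Local Notation S := {mpoly K[N]}.
Implicit Types (s t : seq 'X_{1..N}) (m u : 'X_{1..N}) (f g : S).

Definition divided s m : bool := has (fun m' => (m' <= m)%MM) s.

Lemma dividedP s m : reflect (exists2 m', m' \in s & (m' <= m)%MM) (divided s m).
Proof. exact: hasP. Qed.

Lemma mon_ideal_ideal s : is_ideal (@mon_ideal K N s).
Proof. exact: ideal_genP. Qed.

Lemma mem_mon_ideal s m : m \in s -> @mon_ideal K N s 'X_[m].
Proof. by move=> hm; apply: mem_ideal_gen; exists m. Qed.

Lemma divided_add s m m' : divided s m -> divided s (m' + m)%MM.
Proof.
case/dividedP => m1 h1 h2; apply/dividedP; exists m1 => //.
by apply: lepm_trans h2 _; exact: lem_addl.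
Qed.

Lemma mon_idealP s f :
  mon_ideal s f <-> forall m, m \in msupp f -> divided s m.
Proof.
split=> [|hf]; last first.
  have [_ _ hM] := mon_ideal_ideal s.
  rewrite [f]mpolyE; apply: ideal_sum => [|m /hf /dividedP [m' hm' le]].
    exact: mon_ideal_ideal.
  rewrite -(submK le) mpolyXD scalerAl; apply: hM; exact: mem_mon_ideal.
move: f; apply: ideal_gen_sub => [|f [m hm ->] m'].
  split=> [m|f g hf hg m|f g hg m]; first by rewrite msupp0.
    by move=> /msuppD_le; rewrite mem_cat => /orP [/hf|/hg].
  by move=> /msuppM_le /allpairsP [[m1 m2] /= [_ /hg h ->]]; exact: divided_add.
by move=> /mem_msuppXP <-; apply/dividedP; exists m => //; exact: lepm_refl.
Qed.

Lemma mon_idealX s m : @mon_ideal K N s 'X_[m] <-> divided s m.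
Proof.
rewrite mon_idealP; split=> [|h m' /mem_msuppXP <- //].
by apply; apply/mem_msuppXP.
Qed.

Lemma mon_ideal_colon s u f :
  ideal_colon (mon_ideal s) 'X_[u] f <->
  forall m, m \in msupp f -> divided s (u + m)%MM.
Proof.
rewrite /ideal_colon mon_idealP; split=> h m hm.
  by apply: h; rewrite (perm_mem (msuppMX _ _)) map_f.
by move: hm; rewrite (perm_mem (msuppMX _ _)) => /mapP [m' /h hm' ->].
Qed.

Lemma mon_ideal_sub s t f :
  {subset s <= t} -> mon_ideal s f -> mon_ideal t f.
Proof.
move=> hst /mon_idealP hf; apply/mon_idealP => m /hf /dividedP [m' /hst h1 h2].
by apply/dividedP; exists m'.
Qed.

Lemma mon_ideal_ext s t : s =i t -> same_ideal (@mon_ideal K N s) (mon_ideal t).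
Proof. by move=> h f; split; apply: mon_ideal_sub => m; rewrite h. Qed.

Lemma mon_ideal_rcons s u f :
  mon_ideal (rcons s u) f <-> exists g c, mon_ideal s g /\ f = g + c * 'X_[u].
Proof.
have [h0 hD hM] := mon_ideal_ideal s.
have [k0 kD kM] := mon_ideal_ideal (rcons s u).
split; last first.
  case=> g [c [hg ->]]; apply: kD.
    by apply: mon_ideal_sub hg => m hm; rewrite mem_rcons inE hm orbT.
  by apply: kM; apply: mem_mon_ideal; rewrite mem_rcons mem_head.
move: f; apply: ideal_gen_sub.
  split=> [|_ _ [g [c [hg ->]]] [g' [c' [hg' ->]]]|a _ [g [c [hg ->]]]].
  - by exists 0, 0; rewrite mul0r addr0.
  - by exists (g + g'), (c + c'); split; [exact: hD|rewrite mulrDl addrACA].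
  - by exists (a * g), (a * c); split; [exact: hM|rewrite mulrDr mulrA].
move=> _ [m + ->]; rewrite mem_rcons inE => /orP [/eqP ->|hm].
  by exists 0, 1; rewrite mul1r add0r.
by exists 'X_[m], 0; rewrite mul0r addr0; split=> //; exact: mem_mon_ideal.
Qed.

Lemma mon_ideal_nil : same_ideal (fun f : S => f = 0) (mon_ideal [::]).
Proof.
move=> f; split=> [->|/mon_idealP hf]; first by case: (mon_ideal_ideal [::]).
by apply/eqP; rewrite -msupp_eq0; case: (msupp f) hf => // m l /(_ m (mem_head _ _)).
Qed.

Lemma linearly_resolved_rcons d (C : S -> Prop) s u :
    mdeg u = d -> linearly_resolved d (@mon_ideal K N s) ->
    linearly_resolved 1 C -> same_ideal (ideal_colon (mon_ideal s) 'X_[u]) C ->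
  linearly_resolved d (@mon_ideal K N (rcons s u)).
Proof.
move=> hu [r [E hE]] [rC [EC hEC]] hC.
have hX : ('X_[u] : S) \is d.-homog by rewrite dhomogX /= hu.
have /linear_resolution_ext h := cone_resolution hE hEC hX (fun f => iff_sym (hC f)).
exists (cone_rk r rC), (cone_diff 'X_[u] E EC); apply: h => f.
by rewrite mon_ideal_rcons.
Qed.

(** The Koszul complex as an iterated cone: the colon by a new variable is the ideal itself, so the
    induction hypothesis resolves both J and C. *)
Lemma linearly_resolved_vars (V : seq 'I_N) :
  uniq V -> linearly_resolved 1 (@mon_ideal K N [seq U_(v)%MM | v <- V]).
Proof.
elim/last_ind: V => [|V v IH].
  by move=> _; apply: linearly_resolved_ext mon_ideal_nil _; exact: linearly_resolved0.
rewrite rcons_uniq map_rcons => /andP [hv hV]; have {}IH := IH hV.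
apply: linearly_resolved_rcons (IH) (IH) _; first exact: mdeg1.
move=> f; rewrite mon_ideal_colon mon_idealP; split=> hf m /hf; last exact: divided_add.
case/dividedP => _ /mapP [w hw ->] /mnm_lepP le; apply/dividedP.
exists U_(w)%MM; first exact: map_f.
apply/mnm_lepP => i; have := le i; rewrite mnmDE !mnm1E.
by case: (eqVneq w i) => // <-; case: eqVneq hv => // ->; rewrite hw.
Qed.

Lemma vars_idealE (V : {set 'I_N}) :
  same_ideal (ideal_gen (fun f : S => exists2 v, v \in V & f = 'X_v))
             (mon_ideal [seq U_(v)%MM | v <- enum V]).
Proof.
move=> f; split; apply: ideal_gen_sub => [|g]; try exact: ideal_genP.
  by case=> v hv ->; apply: mem_mon_ideal; apply: map_f; rewrite mem_enum.
case=> _ /mapP [v hv ->] ->; apply: mem_ideal_gen; exists v => //.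
by rewrite mem_enum in hv.
Qed.

Definition linear_colons s : Prop :=
  forall j, (0 < j < size s)%N ->
    exists V : {set 'I_N},
      same_ideal (ideal_colon (mon_ideal (take j s)) 'X_[nth 0%MM s j])
                 (ideal_gen (fun f : S => exists2 v, v \in V & f = 'X_v)).

Lemma linear_colons_resolved d s :
  {in s, forall m, mdeg m = d} -> linear_colons s ->
  linearly_resolved d (@mon_ideal K N s).
Proof.
move=> hd hs; rewrite -(take_size s); have := leqnn (size s).
elim: {1 3}(size s) => [|j IH] hj.
  by rewrite take0; apply: linearly_resolved_ext mon_ideal_nil _; exact: linearly_resolved0.
rewrite (take_nth 0%MM) //; have {}IH := IH (ltnW hj).
case: (posnP j) => [j0|j_gt0].
  (* [linear_colons] starts at j = 1; at j = 0 the colon of the zero ideal is zero, S being a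
     domain. *)
  apply: linearly_resolved_rcons IH (linearly_resolved0 _ _ _) _.
    by apply: hd; exact: mem_nth.
  rewrite j0 take0 => f; apply: iff_trans (iff_sym (mon_ideal_nil _)) _.
  split=> [|->]; last by rewrite mul0r.
  by move/eqP; rewrite mulf_eq0 -!msupp_eq0 msuppX orbF msupp_eq0 => /eqP.
have [|V hV] := hs j; first by rewrite j_gt0.
apply: linearly_resolved_rcons IH (linearly_resolved_vars (enum_uniq V)) _.
  by apply: hd; exact: mem_nth.
by move=> f; apply: iff_trans (hV f) (vars_idealE V f).
Qed.

Lemma linear_colons_linear_quotients d s (J : S -> Prop) :
  uniq s -> {in s, forall m, mdeg m = d} -> linear_colons s ->
  same_ideal J (mon_ideal s) ->
  has_linear_quotients J /\ has_linear_resolution J.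
Proof.
move=> hu hd hs hJ.
have idJ : is_ideal J.
  by apply: is_ideal_ext (mon_ideal_ideal s) => f; apply: iff_sym.
split.
  split.
    move=> f; split=> [/hJ|]; apply: ideal_gen_sub.
    - exact: ideal_genP.
    - move=> _ [m hm ->]; apply: mem_ideal_gen; exists m => //.
      by apply/hJ; exact: mem_mon_ideal.
    - exact: idJ.
    - by move=> _ [m hm ->].
  (* All members of [s] have degree d, so one divides another only if they are equal: no generator
     is redundant. *)
  exists s => //; split=> // t hts hJt m hm.
  have /hJt /mon_idealX /dividedP [m' hm' le] : J 'X_[m].
    by apply/hJ; exact: mem_mon_ideal.
  suff -> : m = m' by [].
  have := congr1 (@mdeg N) (submK le).
  rewrite mdegD (hd _ (hts _ hm')) (hd _ hm) => /(canRL (addnK _)).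
  by rewrite subnn => /eqP; rewrite mdeg_eq0 => /eqP h0; rewrite -(submK le) h0 add0m.
apply: (@linearly_resolved_linear_resolution _ _ d).
  move=> f; split; last by apply: ideal_gen_sub => // g [].
  move/hJ; apply: ideal_gen_sub => [|_ [m hm ->]]; first exact: ideal_genP.
  apply: mem_ideal_gen; split; last by rewrite dhomogX /= hd.
  by apply/hJ; exact: mem_mon_ideal.
apply: linearly_resolved_ext (linear_colons_resolved hd hs).
by move=> f; apply: iff_sym.
Qed.

End MonomialGenerators.

(** * Polystable sets of monomials and their products *)

Section Polystable.
Variables (N : nat) (B : finType) (blk : 'I_N -> B) (rho : 'I_N -> nat).
Hypothesis rho_inj : injective rho.
Implicit Types (s t : seq 'X_{1..N}) (m u : 'X_{1..N}) (v w : 'I_N).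

(** The subtraction is truncated, so this is m x_v / x_w only when x_w divides m. *)
Definition slide v w m : 'X_{1..N} := (m - U_(w) + U_(v))%MM.

Definition polystable s : Prop :=
  forall m v w, m \in s -> blk v = blk w -> (rho v < rho w)%N -> (0 < m w)%N ->
    slide v w m \in s.

Definition block_homog k s : Prop :=
  forall m b, m \in s -> (\sum_(v | blk v == b) m v = k)%N.

Definition lexgt m u : bool :=
  [exists v, (u v < m v)%N && [forall w, (rho w < rho v)%N ==> (m w == u w)]].

Definition lexge m u : bool := (m == u) || lexgt m u.

Lemma lexgtP m u :
  reflect (exists2 v, (u v < m v)%N & forall w, (rho w < rho v)%N -> m w = u w)
          (lexgt m u).
Proof.
apply: (iffP existsP) => [[v /andP [h1 /forallP h2]]|[v h1 h2]]; exists v => //.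
  by move=> w; have /implyP h := h2 w; move=> /h /eqP.
by rewrite h1; apply/forallP => w; apply/implyP => /h2 ->.
Qed.

Lemma lexgt_irr m : lexgt m m = false.
Proof. by apply/lexgtP => -[v]; rewrite ltnn. Qed.

Lemma lexgt_trans : transitive lexgt.
Proof.
move=> m2 m1 m3 /lexgtP [v1 h1 e1] /lexgtP [v2 h2 e2]; apply/lexgtP.
case: (ltngtP (rho v1) (rho v2)) => h.
- exists v1 => [|w hw]; first by rewrite -(e2 _ h).
  by rewrite e1 // e2 // (ltn_trans hw).
- exists v2 => [|w hw]; first by rewrite (e1 _ h).
  by rewrite e1 ?(ltn_trans hw) // e2.
- move/rho_inj: h e2 h2 => <- e2 h2; exists v1 => [|w hw]; first exact: ltn_trans h1.
  by rewrite e1 // e2.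
Qed.

Lemma lexge_refl : reflexive lexge.
Proof. by move=> m; rewrite /lexge eqxx. Qed.

Lemma lexge_trans : transitive lexge.
Proof.
move=> m2 m1 m3 /orP [/eqP -> //|h1] /orP [/eqP <-|h2]; apply/orP; right => //.
exact: lexgt_trans h1 h2.
Qed.

Lemma lexge_total : total lexge.
Proof.
move=> m u; rewrite /lexge; case: (eqVneq m u) => [->|ne] //.
have [v0 hv0] : exists v, m v != u v.
  apply/existsP; apply: contra_neqT ne; rewrite negb_exists => /forallP h.
  by apply/mnmP => v; have := h v; rewrite negbK => /eqP.
have [v hv hmin] := @arg_minnP _ v0 (fun v => m v != u v) rho hv0.
have agree w : (rho w < rho v)%N -> m w = u w.
  by move=> hw; apply/eqP; apply: contraTT hw => /hmin; rewrite -leqNgt.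
rewrite /=; case: (ltngtP (m v) (u v)) hv => // h _.
  by apply/orP; right; apply/lexgtP; exists v => // w /agree.
by apply/orP; left; apply/lexgtP; exists v.
Qed.

Lemma mem_take_lexge s u j :
    sorted lexge s -> uniq s -> (j < size s)%N -> u \in s ->
  (u \in take j s) = lexgt u (nth 0%MM s j).
Proof.
move=> hs hu hj hus; rewrite in_take //.
have hiu : (index u s < size s)%N by rewrite index_mem.
have le i i' := sorted_leq_nth lexge_trans lexge_refl 0%MM hs i i'.
case: ltnP => hlt; apply/esym.
  have := le _ _ hiu hj (ltnW hlt); rewrite nth_index // => /orP [/eqP eq_u|//].
  by move: hlt; rewrite eq_u index_uniq // ltnn.
have := le _ _ hj hiu hlt; rewrite nth_index // => /orP [/eqP ->|h].
  exact: lexgt_irr.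
by apply: contraFF (lexgt_irr u) => h1; exact: lexgt_trans h1 h.
Qed.

Lemma block_homog_mdeg k s m : block_homog k s -> m \in s -> mdeg m = (#|B| * k)%N.
Proof.
move=> hk hm; rewrite mdegE (partition_big blk predT) //=.
under eq_bigr do rewrite hk //.
by rewrite sum_nat_const.
Qed.

(** Let v be the first place where the two differ. Equal degrees in the block of v force u to exceed
    m1 at some w of that block; agreement before v makes w come later, so the exchange of x_w for
    x_v is allowed and raises u. *)
Lemma polystable_slide k s m1 u :
    polystable s -> block_homog k s -> m1 \in s -> u \in s -> lexgt m1 u ->
  exists v w, [/\ (u v < m1 v)%N, (0 < u w)%N, slide v w u \in s & lexgt (slide v w u) u].
Proof.
move=> hs hk hm1 hu /lexgtP [v hv agree].
have [w /andP [/eqP hbw hw]] : exists w, (blk w == blk v) && (m1 w < u w)%N.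
  apply/existsP; apply: contraT; rewrite negb_exists => /forallP h.
  suff : (\sum_(w | blk w == blk v) u w < \sum_(w | blk w == blk v) m1 w)%N.
    by rewrite (hk _ _ hm1) (hk _ _ hu) ltnn.
  rewrite (bigD1 v) //= [X in (_ < X)%N](bigD1 v) //= -addSn leq_add //.
  apply: leq_sum => w /andP [hw _]; by have := h w; rewrite hw /= -leqNgt.
have hrho : (rho v < rho w)%N.
  case: (ltngtP (rho v) (rho w)) hw => // [/agree ->|/rho_inj <-]; first by rewrite ltnn.
  by rewrite ltnNge (ltnW hv).
have uw : (0 < u w)%N by apply: leq_ltn_trans hw.
have nvw : (w == v) = false by apply/eqP => h; rewrite h ltnn in hrho.
exists v, w; split=> //; first exact: hs.
apply/lexgtP; exists v => [|x hx]; rewrite !mnmE.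
  by rewrite nvw eqxx subn0 addn1.
case: (eqVneq v x) hx => [->|_ hx]; first by rewrite ltnn.
case: (eqVneq w x) hx hrho => [->|_ _ _]; last by rewrite subn0 addn0.
by move=> h1 /(ltn_trans h1); rewrite ltnn.
Qed.

Variable K : fieldType.

Lemma polystable_linear_colons k s :
    uniq s -> polystable s -> block_homog k s ->
  linear_colons K (sort lexge s).
Proof.
move=> us hs hk j /andP [_ hj].
have ss := sort_sorted lexge_total s; set t := sort lexge s in hj ss *.
have ts : t =i s by apply: mem_sort.
have ut : uniq t by rewrite sort_uniq.
set u := nth _ _ _; have hu : u \in s by rewrite -ts mem_nth.
(* V is the set of all variables in the colon ideal; the point is that they generate it. *)
exists [set v | divided (take j t) (u + U_(v))%MM] => f.
rewrite vars_idealE mon_idealP mon_ideal_colon.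
split=> h m /h {h} /dividedP [m1]; last first.
  case/mapP => v; rewrite mem_enum inE => hv -> le.
  by rewrite -(submK le) addmA [(u + _)%MM]addmC -addmA; exact: divided_add.
move=> hm1 /mnm_lepP le; have hm1t := mem_take hm1.
have gt1 : lexgt m1 u by rewrite -mem_take_lexge.
rewrite ts in hm1t.
have [v [w [hv hw hsl gt2]]] := polystable_slide hs hk hm1t hu gt1.
apply/dividedP; exists U_(v)%MM.
  apply: map_f; rewrite mem_enum inE; apply/dividedP; exists (slide v w u).
    by rewrite mem_take_lexge // ts.
  by apply/mnm_lepP => x; rewrite !mnmE leq_add2r leq_subr.
(* x_v divides m: m1 divides u m and has a larger exponent than u at v. *)
apply/mnm_lepP => x; rewrite mnm1E; case: eqVneq => //= <-.
by have := leq_trans hv (le v); rewrite mnmDE -[X in (X < _)%N]addn0 ltn_add2l.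
Qed.

Lemma polystable_linear k s (J : {mpoly K[N]} -> Prop) :
    polystable s -> block_homog k s -> same_ideal J (mon_ideal s) ->
  has_linear_quotients J /\ has_linear_resolution J.
Proof.
(* A list of products may contain repetitions. *)
move=> hs hk hJ; pose t := undup s.
have ht : t =i s by exact: mem_undup.
have hst : polystable t by move=> m v w; rewrite !ht; exact: hs.
have hkt : block_homog k t by move=> m b; rewrite ht; exact: hk.
apply: (@linear_colons_linear_quotients _ _ (#|B| * k) (sort lexge t)).
- by rewrite sort_uniq undup_uniq.
- by move=> m; rewrite mem_sort; exact: block_homog_mdeg.
- exact: polystable_linear_colons (undup_uniq s) hst hkt.
- move=> f; rewrite hJ; apply: mon_ideal_ext => m.
  by rewrite mem_sort ht.
Qed.

Definition mon_mul s t : seq 'X_{1..N} := [seq (m1 + m2)%MM | m1 <- s, m2 <- t].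

Fixpoint mon_exp s k : seq 'X_{1..N} :=
  if k is k'.+1 then mon_mul s (mon_exp s k') else [:: 0%MM].

Lemma slideDl v w m1 m2 : (0 < m1 w)%N -> slide v w (m1 + m2) = (slide v w m1 + m2)%MM.
Proof.
move=> h; apply/mnmP => x; rewrite !mnmE.
have le : ((w == x) <= m1 x)%N by case: (eqVneq w x) h => [->|].
by rewrite -(addnBAC (m2 x) le) addnAC.
Qed.

(** x_w divides one of the two factors, and the exchange is made there. *)
Lemma polystable_mul s t : polystable s -> polystable t -> polystable (mon_mul s t).
Proof.
move=> hs ht m v w /allpairsP [[m1 m2] /= [h1 h2 ->]] hb hr; rewrite mnmDE.
case: (posnP (m1 w)) => [->|pos] h.
  rewrite add0n in h; rewrite addmC slideDl // addmC.
  by apply/allpairsP; exists (m1, slide v w m2); split=> //; exact: ht.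
rewrite slideDl //.
by apply/allpairsP; exists (slide v w m1, m2); split=> //; exact: hs.
Qed.

Lemma block_homog_mul j k s t :
  block_homog j s -> block_homog k t -> block_homog (j + k) (mon_mul s t).
Proof.
move=> hs ht m b /allpairsP [[m1 m2] /= [h1 h2 ->]].
by under eq_bigr do rewrite mnmDE; rewrite big_split /= hs // ht.
Qed.

Lemma polystable_exp s k : polystable s -> polystable (mon_exp s k).
Proof.
move=> hs; elim: k => [|k IH] /=; last exact: polystable_mul.
by move=> m v w; rewrite inE => /eqP ->; rewrite mnm0E.
Qed.

Lemma block_homog_exp s k : block_homog 1 s -> block_homog k (mon_exp s k).
Proof.
move=> hs; elim: k => [|k IH] /=; last exact: (block_homog_mul hs IH).
by move=> m v; rewrite inE => /eqP ->; apply: big1 => w _; rewrite mnm0E.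
Qed.

Lemma mon_exp_ideal s k (J : {mpoly K[N]} -> Prop) :
  same_ideal J (mon_ideal s) -> same_ideal (ideal_exp J k) (mon_ideal (mon_exp s k)).
Proof.
move=> hJ; elim: k => [|k IH] f /=.
  split=> // _; apply/mon_idealP => m _; apply/dividedP.
  by exists 0%MM; rewrite ?mem_head //; apply/mnm_lepP => i; rewrite mnm0E.
split; apply: ideal_gen_sub.
- exact: mon_ideal_ideal.
- move=> _ [g [h [/hJ /mon_idealP hg /IH /mon_idealP hh ->]]].
  apply/mon_idealP => m /msuppM_le /allpairsP [[m1 m2] /= []].
  move=> /hg /dividedP [m1' h1 le1] /hh /dividedP [m2' h2 le2] ->.
  apply/dividedP; exists (m1' + m2')%MM; last first.
    by apply/mnm_lepP => x; rewrite !mnmDE leq_add ?(mnm_lepP le1) ?(mnm_lepP le2).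
  by apply/allpairsP; exists (m1', m2').
- exact: ideal_genP.
- move=> _ [m /allpairsP [[m1 m2] /= [h1 h2 ->]] ->]; apply: mem_ideal_gen.
  exists 'X_[m1], 'X_[m2]; rewrite mpolyXD; split=> //.
    by apply/hJ; exact: mem_mon_ideal.
  by apply/IH; exact: mem_mon_ideal.
Qed.

End Polystable.

(** * The generators of L(I) *)

Section Letterplace.
Variables (K : fieldType) (n : nat) (I : {mpoly K[n]} -> Prop).
Hypothesis idI : is_ideal I.

Local Notation N := #|{: pvar I}|.

Definition pblock (v : 'I_N) : 'I_n := tag (enum_val v : pvar I).
Definition pheight (v : 'I_N) : nat := tagged (enum_val v : pvar I).
(** Height first, ties broken by the block: injective, and increasing with height inside a block. *)
Definition prank (v : 'I_N) : nat := (pheight v * n + pblock v)%N.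

Lemma prank_inj : injective prank.
Proof.
move=> v w eq_vw.
have n_gt0 : (0 < n)%N by apply: leq_ltn_trans (ltn_ord (pblock v)).
have eq_h : pheight v = pheight w.
  have := congr1 (fun x => x %/ n)%N eq_vw; rewrite /prank !divnMDl //.
  by rewrite !divn_small ?addn0 ?ltn_ord.
have /val_inj eq_b : val (pblock v) = val (pblock w).
  by have := eq_vw; rewrite /prank eq_h => /addnI.
apply: enum_val_inj; move: eq_b eq_h; rewrite /pblock /pheight.
case: (enum_val v) (enum_val w) => [i x] [j y] /= eq_ij.
by case: j / eq_ij y => y /val_inj ->.
Qed.

Definition exponents (f : {ffun 'I_n -> 'I_N}) : 'X_{1..n} :=
  [multinom pheight (f i) | i < n].

Definition transversal_mon (f : {ffun 'I_n -> 'I_N}) : 'X_{1..N} :=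
  (\sum_(i < n) U_(f i))%MM.

(** Excluded middle makes membership in [I] boolean, so that the generators can be listed. *)
Definition standard (f : {ffun 'I_n -> 'I_N}) : bool :=
  [forall i, pblock (f i) == i] &&
  (if excluded_middle_informative (I 'X_[exponents f]) then false else true).

Lemma standardP (f : {ffun 'I_n -> 'I_N}) :
  reflect ((forall i, pblock (f i) = i) /\ ~ I 'X_[exponents f]) (standard f).
Proof.
apply: (iffP andP) => -[h1 h2]; split.
- by move=> i; apply/eqP; exact: (forallP h1).
- by case: excluded_middle_informative h2.
- by apply/forallP => i; apply/eqP.
- by case: excluded_middle_informative.
Qed.

Definition L_mons : seq 'X_{1..N} :=
  [seq transversal_mon f | f <- enum [pred f | standard f]].

Lemma L_monsP m :
  reflect (exists2 f, standard f & m = transversal_mon f) (m \in L_mons).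
Proof.
apply: (iffP mapP) => -[f hf ->]; exists f => //; first by rewrite mem_enum in hf.
by rewrite mem_enum.
Qed.

Lemma L_ideal_mons : same_ideal (L_ideal I) (mon_ideal L_mons).
Proof.
move=> g; split; apply: ideal_gen_sub; try exact: ideal_genP.
- move=> _ [a [c [ha hc ->]]].
  pose f := [ffun i => enum_rank (Tagged (fun i => 'I_(min_pow I i)) (c i) : pvar I)].
  have hf i : enum_val (f i) = Tagged (fun i => 'I_(min_pow I i)) (c i).
    by rewrite ffunE enum_rankK.
  have -> : \prod_i pX I i (c i) = 'X_[transversal_mon f].
    by rewrite -mprodXE; apply: eq_bigr => i _; rewrite /pX ffunE.
  apply: mem_mon_ideal; apply/L_monsP; exists f => //; apply/standardP; split=> [i|].
    by rewrite /pblock hf.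
  suff -> : exponents f = a by [].
  by apply/mnmP => i; rewrite mnmE /pheight hf -hc.
- move=> _ [_ /L_monsP [f /standardP [hb hI] ->] ->]; apply: mem_ideal_gen.
  have /fin_all_exists [c hc] i : exists c : 'I_(min_pow I i),
      enum_val (f i) = Tagged (fun i => 'I_(min_pow I i)) c.
    have := hb i; rewrite /pblock; case: (enum_val (f i)) => [j x] /= eq_ji.
    by case: i / eq_ji; exists x.
  exists (exponents f), c; split=> // [i|]; first by rewrite mnmE /pheight hc.
  rewrite -mprodXE; apply: eq_bigr => i _; congr 'X_[U_(_)].
  by rewrite -[f i]enum_valK hc.
Qed.

Lemma L_mons_homog : block_homog pblock 1 L_mons.
Proof.
move=> _ b /L_monsP [f /standardP [hb _] ->].
under eq_bigr do rewrite /transversal_mon mnm_sumE.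
rewrite exchange_big /= (bigD1 b) //= (bigD1 (f b)) /= ?hb // mnm1E eqxx.
rewrite !big1 // => [i ne|v /andP [_ ne]]; last by rewrite mnm1E eq_sym (negPf ne).
apply: big1 => v /eqP hv; rewrite mnm1E; case: eqVneq => // hfv.
by rewrite -hv -hfv hb eqxx in ne.
Qed.

(** Passing to a variable of lower rank in block b lowers or keeps the exponent of x_b; the new
    monomial divides one outside the ideal [I], so it is outside too. *)
Lemma L_mons_polystable : polystable pblock prank L_mons.
Proof.
move=> _ v w /L_monsP [f /standardP [hb hI] ->] hvw hr.
rewrite /transversal_mon mnm_sumE lt0n sum_nat_eq0 negb_forall => /existsP [b].
rewrite mnm1E eqb0 negbK => /eqP hfb.
have bw : pblock w = b by rewrite -hfb hb.
have le : (pheight v <= pheight w)%N.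
  have n_gt0 : (0 < n)%N by apply: leq_ltn_trans (ltn_ord b).
  by move: hr; rewrite /prank hvw ltn_add2r ltn_pmul2r // => /ltnW.
pose f' := [ffun i => if i == b then v else f i].
have le_f' : (exponents f' <= exponents f)%MM.
  apply/mnm_lepP => i; rewrite !mnmE ffunE; case: eqVneq => // ->.
  by rewrite hfb.
apply/L_monsP; exists f'.
  apply/standardP; split=> [i|hI'].
    by rewrite ffunE; case: eqVneq => // ->; rewrite hvw.
  by apply: hI; rewrite -(submK le_f') mpolyXD; case: idI => _ _; apply.
rewrite /slide /transversal_mon (bigD1 b) //= [in RHS](bigD1 b) //= ffunE eqxx hfb.
rewrite [RHS]addmC [(U_(w) + _)%MM]addmC addmK; congr (_ + _)%MM.
by apply: eq_bigr => i /negPf ne; rewrite ffunE ne.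
Qed.

End Letterplace.

Theorem theorem4p1 (K : fieldType) (n : nat) (I : {mpoly K[n]} -> Prop)
    (hI : is_monomial_ideal I) (hdim : quot_krull_dim I 0) :
  (forall k : nat, (1 <= k)%N -> has_linear_quotients (ideal_exp (L_ideal I) k)) /\
  (forall k : nat, (1 <= k)%N -> has_linear_resolution (ideal_exp (L_ideal I) k)).
Proof.
have idI : is_ideal I.
  by apply: is_ideal_ext (ideal_genP _) => f; apply: iff_sym.
have main k : has_linear_quotients (ideal_exp (L_ideal I) k) /\
    has_linear_resolution (ideal_exp (L_ideal I) k).
  apply: (polystable_linear (s := mon_exp (L_mons I) k) (@prank_inj K n I)).
  - apply: polystable_exp; exact: L_mons_polystable idI.
  - exact: block_homog_exp (@L_mons_homog _ _ _).
  - exact: mon_exp_ideal (@L_ideal_mons _ _ _).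
by split=> k _; have [] := main k.
Qed.
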